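(* Let $(E,d)$ be an $(\varepsilon,\lambda)$-complete $RM$ space with base $(\Omega,\mathcal{F},P)$, let $\alpha\in L^0_+(\mathcal{F})$ satisfy $\alpha<1$ on $\Omega$, and let $T:E\to CB_{\sigma}(E)$ be a mapping such that $H(T(x),T(y))\le\alpha\cdot d(x,y)$ for any $x,y\in E$. Then there exists $x\in E$ such that $x\in T(x)$.
   Context: $(\Omega,\mathcal{F},P)$ is a probability space. $L^0(\mathcal{F})$ is the set of equivalence classes (under a.s. equality) of real-valued $\mathcal{F}$-measurable random variables, ordered by $\xi\le\eta$ iff $\xi^0\le\eta^0$ a.s. for representatives; $\bigvee$ and $\bigwedge$ denote supremum and infimum in the complete lattice $\bar{L}^0(\mathcal{F})$ of equivalence classes of extended real-valued random variables. $L^0_+(\mathcal{F})=\{\xi\in L^0(\mathcal{F}):\xi\ge0\}$. ''$\alpha<1$ on $\Omega$'' means that a representative satisfies $\alpha^0<1$ a.s. $\tilde{I}_A$ is the equivalence class of the characteristic function of $A\in\mathcal{F}$. An $RM$ (random metric) space with base $(\Omega,\mathcal{F},P)$ is a pair $(E,d)$, $E$ a nonempty set and $d:E\times E\to L^0_+(\mathcal{F})$, such that $d(p,q)=0$ iff $p=q$, $d(p,q)=d(q,p)$, and $d(p,r)\le d(p,q)+d(q,r)$. The $(\varepsilon,\lambda)$-uniformity on $E$ has as base the sets $\{(x,y)\in E\times E: P\{\omega: d(x,y)(\omega)<\varepsilon\}>1-\lambda\}$ for real $\varepsilon>0$, $0<\lambda<1$; its topology is $\mathcal{T}_{\varepsilon,\lambda}$;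 $(E,d)$ is $(\varepsilon,\lambda)$-complete if it is complete in this uniformity. A countable partition $\{A_n:n\in N\}$ of $\Omega$ to $\mathcal{F}$ is a sequence of pairwise disjoint members of $\mathcal{F}$ with union $\Omega$. A nonempty $G\subset E$ is $d$-$\sigma$-stable if for each sequence $\{x_n\}$ in $G$ and each countable partition $\{A_n\}$ of $\Omega$ to $\mathcal{F}$ there is $x\in G$ with $\tilde{I}_{A_n}\cdot d(x,x_n)=0$ for all $n$. A nonempty $G\subset E$ is a.s. bounded if $\bigvee\{d(x,y):x,y\in G\}\in L^0_+(\mathcal{F})$. $CB_{\sigma}(E)$ is the family of nonempty subsets of $E$ that are a.s. bounded, $\mathcal{T}_{\varepsilon,\lambda}$-closed and $d$-$\sigma$-stable. For $x\in E$ and nonempty $G\subset E$, $d(x,G)=\bigwedge\{d(x,g):g\in G\}$. The random Hausdorff metric $H:CB_\sigma(E)\times CB_\sigma(E)\to L^0_+(\mathcal{F})$ is $H(G_1,G_2)=\max\{\bigvee_{x_1\in G_1}d(x_1,G_2),\ \bigvee_{x_2\in G_2}d(x_2,G_1)\}$, the max being taken in $L^0(\mathcal{F})$ (a.s. pointwise). *)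

(* Defs.v *)
From HB Require Import structures.
From mathcomp Require Import all_boot all_order all_algebra generic_quotient.
From mathcomp Require Import all_classical all_reals all_analysis.
From mathcomp Require Import measurable_realfun.
Import Order.TTheory GRing.Theory Num.Theory.
Import numFieldNormedType.Exports.

Set Implicit Arguments.
Unset Strict Implicit.
Unset Printing Implicit Defensive.

Local Open Scope classical_set_scope.
Local Open Scope ring_scope.
Local Open Scope quotient_scope.

Section L0_spaces.
Context {d : measure_display} {Omega : measurableType d} {R : realType}.
Variable P : probability Omega R.

Definition L0 : Type := {mfun_ P, Omega >-> R}.
HB.instance Definition _ := Choice.on L0.
HB.instance Definition _ := EqQuotient.on L0.

Definition L0bar : Type := {mfun_ P, Omega >-> \bar R}.
HB.instance Definition _ := Choice.on L0bar.
HB.instance Definition _ := EqQuotient.on L0bar.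

Definition L0_fun (f : L0) : {mfun Omega >-> R} := repr f.
Definition L0bar_fun (f : L0bar) : {mfun Omega >-> \bar R} := repr f.

End L0_spaces.

Coercion L0_fun : L0 >-> MeasurableFun.type.
Coercion L0bar_fun : L0bar >-> MeasurableFun.type.

Section L0_order.
Context {d : measure_display} {Omega : measurableType d} {R : realType}.
Context {P : probability Omega R}.

Lemma L0_pi_eqP (f g : {mfun Omega >-> R}) :
  \pi_(L0 P) f = \pi_(L0 P) g <-> \forall w \ae P, f w = g w.
Proof.
split=> [/eqP|fg]; last apply/eqP; rewrite eqmodE.
  by move=> /asboolP; apply: filterS => w; exact.
by apply/asboolP; apply: filterS fg.
Qed.

Lemma L0bar_pi_eqP (f g : {mfun Omega >-> \bar R}) :
  \pi_(L0bar P) f = \pi_(L0bar P) g <-> \forall w \ae P, f w = g w.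
Proof.
split=> [/eqP|fg]; last apply/eqP; rewrite eqmodE.
  by move=> /asboolP; apply: filterS => w; exact.
by apply/asboolP; apply: filterS fg.
Qed.

Lemma L0_piE (f : {mfun Omega >-> R}) :
  \forall w \ae P, (\pi_(L0 P) f : L0 P) w = f w.
Proof. by apply/L0_pi_eqP; rewrite /L0_fun reprK. Qed.

Lemma L0bar_piE (f : {mfun Omega >-> \bar R}) :
  \forall w \ae P, (\pi_(L0bar P) f : L0bar P) w = f w.
Proof. by apply/L0bar_pi_eqP; rewrite /L0bar_fun reprK. Qed.

Lemma L0_eqP (f g : L0 P) : f = g <-> \forall w \ae P, f w = g w.
Proof. by rewrite -L0_pi_eqP /L0_fun !reprK. Qed.

Lemma L0bar_eqP (f g : L0bar P) : f = g <-> \forall w \ae P, f w = g w.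
Proof. by rewrite -L0bar_pi_eqP /L0bar_fun !reprK. Qed.

(* The strict order [f < g] attached to [L0_le] means [f <= g] and [f != g];
   it is not the almost sure strict inequality. *)
Definition L0_le (f g : L0 P) := `[< \forall w \ae P, f w <= g w >].

Let L0_le_refl : reflexive L0_le.
Proof. by move=> f; apply/asboolP/aeW. Qed.

Let L0_le_anti : antisymmetric L0_le.
Proof.
move=> f g /andP[/asboolP fg /asboolP gf]; apply/L0_eqP.
by apply: filterS2 fg gf => w fg gf; apply/le_anti/andP.
Qed.

Let L0_le_trans : transitive L0_le.
Proof.
move=> g f h /asboolP fg /asboolP gh; apply/asboolP.
by apply: filterS2 fg gh => w; exact: le_trans.
Qed.

HB.instance Definition _ := Order.Le_isPOrder.Build ring_display (L0 P)
  L0_le_refl L0_le_anti L0_le_trans.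

Definition L0bar_le (f g : L0bar P) := `[< \forall w \ae P, (f w <= g w)%E >].

Let L0bar_le_refl : reflexive L0bar_le.
Proof. by move=> f; apply/asboolP/aeW. Qed.

Let L0bar_le_anti : antisymmetric L0bar_le.
Proof.
move=> f g /andP[/asboolP fg /asboolP gf]; apply/L0bar_eqP.
by apply: filterS2 fg gf => w fg gf; apply/le_anti/andP.
Qed.

Let L0bar_le_trans : transitive L0bar_le.
Proof.
move=> g f h /asboolP fg /asboolP gh; apply/asboolP.
by apply: filterS2 fg gh => w; exact: le_trans.
Qed.

HB.instance Definition _ := Order.Le_isPOrder.Build ring_display (L0bar P)
  L0bar_le_refl L0bar_le_anti L0bar_le_trans.

Lemma L0_leP (f g : L0 P) :
  reflect (\forall w \ae P, f w <= g w) (f <= g).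
Proof. exact: asboolP. Qed.

Lemma L0bar_leP (f g : L0bar P) :
  reflect (\forall w \ae P, (f w <= g w)%E) (f <= g).
Proof. exact: asboolP. Qed.

End L0_order.

Section L0_ring.
Context {d : measure_display} {Omega : measurableType d} {R : realType}.
Context {P : probability Omega R}.
Implicit Types f g h : L0 P.

Definition L0_zero : L0 P := \pi_(L0 P) 0.
Definition L0_one : L0 P := \pi_(L0 P) 1.
Definition L0_opp f : L0 P := \pi_(L0 P) (- L0_fun f).
Definition L0_add f g : L0 P := \pi_(L0 P) (L0_fun f + L0_fun g).
Definition L0_mul f g : L0 P := \pi_(L0 P) (L0_fun f * L0_fun g).

Lemma L0_zeroE : \forall w \ae P, L0_zero w = 0.
Proof. exact: L0_piE. Qed.

Lemma L0_oneE : \forall w \ae P, L0_one w = 1.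
Proof. exact: L0_piE. Qed.

Lemma L0_oppE f : \forall w \ae P, L0_opp f w = - f w.
Proof. exact: L0_piE. Qed.

Lemma L0_addE f g : \forall w \ae P, L0_add f g w = f w + g w.
Proof. exact: L0_piE. Qed.

Lemma L0_mulE f g : \forall w \ae P, L0_mul f g w = f w * g w.
Proof. exact: L0_piE. Qed.

Let L0_addA : associative L0_add.
Proof.
move=> f g h; apply/L0_eqP; near=> w.
rewrite (near (L0_addE f (L0_add g h)) w)//.
rewrite (near (L0_addE (L0_add f g) h) w)//.
by rewrite (near (L0_addE g h) w)// (near (L0_addE f g) w)// addrA.
Unshelve. all: by end_near. Qed.

Let L0_addC : commutative L0_add.
Proof. by move=> f g; rewrite /L0_add addrC. Qed.

Let L0_add0 : left_id L0_zero L0_add.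
Proof.
move=> f; apply/L0_eqP; near=> w.
by rewrite (near (L0_addE L0_zero f) w)// (near L0_zeroE w)// add0r.
Unshelve. all: by end_near. Qed.

Let L0_addN : left_inverse L0_zero L0_opp L0_add.
Proof.
move=> f; apply/L0_eqP; near=> w.
rewrite (near (L0_addE (L0_opp f) f) w)// (near (L0_oppE f) w)//.
by rewrite (near L0_zeroE w)// addNr.
Unshelve. all: by end_near. Qed.

HB.instance Definition _ := GRing.isZmodule.Build (L0 P)
  L0_addA L0_addC L0_add0 L0_addN.

Let L0_mulA : associative L0_mul.
Proof.
move=> f g h; apply/L0_eqP; near=> w.
rewrite (near (L0_mulE f (L0_mul g h)) w)//.
rewrite (near (L0_mulE (L0_mul f g) h) w)//.
by rewrite (near (L0_mulE g h) w)// (near (L0_mulE f g) w)// mulrA.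
Unshelve. all: by end_near. Qed.

Let L0_mulC : commutative L0_mul.
Proof. by move=> f g; rewrite /L0_mul mulrC. Qed.

Let L0_mul1 : left_id L0_one L0_mul.
Proof.
move=> f; apply/L0_eqP; near=> w.
by rewrite (near (L0_mulE L0_one f) w)// (near L0_oneE w)// mul1r.
Unshelve. all: by end_near. Qed.

Let L0_mulDl : left_distributive L0_mul L0_add.
Proof.
move=> f g h; apply/L0_eqP; near=> w.
rewrite (near (L0_mulE (L0_add f g) h) w)// (near (L0_addE f g) w)//.
rewrite (near (L0_addE (L0_mul f h) (L0_mul g h)) w)//.
by rewrite (near (L0_mulE f h) w)// (near (L0_mulE g h) w)// mulrDl.
Unshelve. all: by end_near. Qed.

Let L0_one_neq0 : L0_one != L0_zero.
Proof.
apply/eqP => /L0_eqP e; have ae_proper : ProperFilter (almost_everywhere P).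
  apply: ae_properfilter_algebraOfSetsType.
  by rewrite [ltRHS]probability_setT.
apply: (@filter_not_empty _ _ ae_proper).
apply: filterS3 L0_oneE L0_zeroE e => w -> -> /eqP; exact/negP/oner_neq0.
Qed.

HB.instance Definition _ := GRing.Zmodule_isComNzRing.Build (L0 P)
  L0_mulA L0_mulC L0_mul1 L0_mulDl L0_one_neq0.

Lemma L0_0E : \forall w \ae P, (0 : L0 P) w = 0.
Proof. exact: L0_zeroE. Qed.

Lemma L0_1E : \forall w \ae P, (1 : L0 P) w = 1.
Proof. exact: L0_oneE. Qed.

Lemma L0_NE f : \forall w \ae P, (- f : L0 P) w = - f w.
Proof. exact: L0_oppE. Qed.

Lemma L0_DE f g : \forall w \ae P, (f + g : L0 P) w = f w + g w.
Proof. exact: L0_addE. Qed.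

Lemma L0_ME f g : \forall w \ae P, (f * g : L0 P) w = f w * g w.
Proof. exact: L0_mulE. Qed.

End L0_ring.

Section L0_operations.
Context {d : measure_display} {Omega : measurableType d} {R : realType}.
Variable P : probability Omega R.

Definition L0_indic (A : set Omega) (mA : measurable A) : L0 P :=
  \pi_(L0 P) (indic_mfun A mA).

Lemma L0_indicE A (mA : measurable A) :
  \forall w \ae P, L0_indic mA w = \1_A w.
Proof. exact: L0_piE. Qed.

Definition L0bar_pi (f : Omega -> \bar R) (mf : measurable_fun setT f) :
  L0bar P := \pi_(L0bar P) (mfun_Sub (mem_set mf)).

Lemma L0bar_pi_funE f (mf : measurable_fun setT f) :
  \forall w \ae P, L0bar_pi mf w = f w.
Proof. exact: L0bar_piE. Qed.

Definition L0_EFin (f : L0 P) : L0bar P :=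
  L0bar_pi (measurableT_comp (@EFin_measurable R setT) (measurable_funPT f)).

Definition L0bar_max (f g : L0bar P) : L0bar P :=
  L0bar_pi (measurable_maxe (measurable_funPT f) (measurable_funPT g)).

End L0_operations.

Section L0_supremum.
Context {d : measure_display} {Omega : measurableType d} {R : realType}.
Context {P : probability Omega R}.

(* [L0bar P] is a complete lattice, so the default values given to [supremum]
   and [infimum] only matter for the empty family. *)
Definition L0bar_sup (A : set (L0bar P)) : L0bar P :=
  supremum (L0bar_pi P (measurable_cst -oo%E)) A.

Definition L0bar_inf (A : set (L0bar P)) : L0bar P :=
  infimum (L0bar_pi P (measurable_cst +oo%E)) A.

End L0_supremum.

Record rmSpace {d : measure_display} {Omega : measurableType d}
    {R : realType} (P : probability Omega R) := RMSpace {
  rm_sort :> Type;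
  rm_dist : rm_sort -> rm_sort -> L0 P;
  rm_nonempty : inhabited rm_sort;
  rm_dist_ge0 : forall p q, 0 <= rm_dist p q;
  rm_dist_eq0 : forall p q, rm_dist p q = 0 <-> p = q;
  rm_distC : forall p q, rm_dist p q = rm_dist q p;
  rm_dist_triangle : forall p q r, rm_dist p r <= rm_dist p q + rm_dist q r
}.

Section rm_uniformity.
Context {d : measure_display} {Omega : measurableType d} {R : realType}.
Context {P : probability Omega R}.
Variable E : rmSpace P.
Implicit Types (x y : E) (e l : R).

Definition eps_lambda (el : R * R) : set (E * E) :=
  [set xy | (P [set w | (rm_dist xy.1 xy.2 w < el.1)%R] > (1 - el.2)%:E)%E].

Definition eps_lambda_ent : set_system (E * E) :=
  filter_from [set el : R * R | 0 < el.1 /\ 0 < el.2 < 1] eps_lambda.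

Let measurable_lt (f : L0 P) e : measurable [set w | f w < e].
Proof.
rewrite (_ : [set _ | _] = f @^-1` `]-oo, e[); last first.
  by apply/seteqP; split => w /=; rewrite in_itv.
exact: measurable_funPTI.
Qed.

Let le_prob (A B : set Omega) : measurable A -> measurable B ->
  (\forall w \ae P, A w -> B w) -> (P A <= P B)%E.
Proof.
move=> mA mB [N [mN N0 AB]].
rewrite -[leRHS]adde0 -N0; apply: le_trans (measureU2 _ _ _) => //.
apply: le_measure; rewrite ?inE//; first exact: measurableU.
move=> w Aw; have [Bw|nBw] := pselect (B w); first by left.
by right; apply: AB => /= h; exact/nBw/h.
Qed.

Let eps_lambdaS e l e' l' : e <= e' -> l <= l' ->
  eps_lambda (e, l) `<=` eps_lambda (e', l').
Proof.
move=> ee ll [x y]; rewrite /eps_lambda /= => h.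
apply: (@le_lt_trans _ _ (1 - l)%:E); first by rewrite lee_fin lerB.
apply: (lt_le_trans h); apply: le_prob => //.
by apply: aeW => w /lt_le_trans; exact.
Qed.

Let ent_filter : Filter eps_lambda_ent.
Proof.
apply: filter_from_filter.
  by exists (1, 2^-1) => /=; rewrite ltr01 invr_gt0 ltr0n invf_lt1 ?ltr1n.
move=> [e l] [e' l'] /= [e0 /andP[l0 l1]] [e'0 /andP[l'0 l'1]].
exists (Num.min e e', Num.min l l').
  by rewrite /= !lt_min e0 e'0 l0 l'0 gt_min l1.
by move=> xy h; split; apply: eps_lambdaS h; rewrite ge_min lexx ?orbT.
Qed.

Let ent_diagonal A : eps_lambda_ent A -> diagonal `<=` A.
Proof.
move=> [[e l] /= [e0 /andP[l0 _]] elA] [x y] /= xy; apply: elA.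
rewrite /eps_lambda/=; apply: (@lt_le_trans _ _ 1%E).
  by rewrite lte_fin gtrBl.
rewrite -(@probability_setT _ _ _ P); apply: le_prob => //.
have -> : rm_dist x y = 0 by exact/rm_dist_eq0.
by apply: filterS L0_0E => w /= -> _.
Qed.

Let ent_inv A : eps_lambda_ent A -> eps_lambda_ent A^-1%relation.
Proof.
move=> [el el0 elA]; exists el => // -[x y] xy; apply: elA.
by move: xy; rewrite /eps_lambda /= rm_distC.
Qed.

Let ent_split A : eps_lambda_ent A ->
  exists2 B, eps_lambda_ent B & (B \; B `<=` A)%relation.
Proof.
move=> [[e l] /= [e0 /andP[l0 l1]] elA].
exists (eps_lambda (e / 2, l / 2)).
  exists (e / 2, l / 2) => //=; rewrite !divr_gt0//; split => //=.
  by rewrite ltr_pdivrMr// mul1r (lt_trans l1)// ltr1n.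
move=> [x z] [y /=]; rewrite /eps_lambda /= => xy yz; apply: elA.
rewrite /eps_lambda/=.
set U := [set w | rm_dist x y w < e / 2] in xy.
set V := [set w | rm_dist y z w < e / 2] in yz.
have mU : measurable U by exact: measurable_lt.
have mV : measurable V by exact: measurable_lt.
have PUC : (P (~` U) < (l / 2)%:E)%E.
  rewrite probability_setC// lteBlDr ?fin_num_measure//.
  by rewrite addeC -lteBlDr// -EFinB.
have PVC : (P (~` V) < (l / 2)%:E)%E.
  rewrite probability_setC// lteBlDr ?fin_num_measure//.
  by rewrite addeC -lteBlDr// -EFinB.
apply: (@lt_le_trans _ _ (P (U `&` V))); last first.
  apply: le_prob => //; first exact: measurableI.
  have /L0_leP := rm_dist_triangle x y z; move=> tri.
  apply: filterS2 tri (L0_DE (rm_dist x y) (rm_dist y z)) => w.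
  move=> h hD [/= Uw Vw]; rewrite (le_lt_trans h)// hD.
  by rewrite [ltRHS](splitr e) ltrD.
have mUV : measurable (~` (U `&` V)) by exact/measurableC/measurableI.
rewrite -[U `&` V]setCK probability_setC//.
rewrite EFinB lteBrDr ?fin_num_measure// setCI.
apply: (@lt_le_trans _ _ (1 - l%:E + l%:E)%E); last first.
  by rewrite subeK.
rewrite lteD2lE//; apply: (@le_lt_trans _ _ (P (~` U) + P (~` V))%E).
  by apply: measureU2; exact: measurableC.
by rewrite (splitr l) EFinD lteD.
Qed.

HB.instance Definition _ := gen_eqMixin (rm_sort E).
HB.instance Definition _ := gen_choiceMixin (rm_sort E).
HB.instance Definition _ := isUniform.Build (rm_sort E)
  ent_filter ent_diagonal ent_inv ent_split.

Lemma rm_entourageE : @entourage E = eps_lambda_ent.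
Proof. by []. Qed.

Lemma rm_nbhsE : @nbhs E E = nbhs_ eps_lambda_ent.
Proof. by []. Qed.

End rm_uniformity.

Section random_hausdorff.
Context {d : measure_display} {Omega : measurableType d} {R : realType}.
Context {P : probability Omega R}.
Variable E : rmSpace P.
Implicit Types (x y : E) (G : set E).

Definition eps_lambda_complete :=
  forall F : set_system E, ProperFilter F -> cauchy F -> exists x, F --> x.

Definition sigma_stable G :=
  forall (x_ : nat -> E) (A_ : nat -> set Omega)
    (mA : forall n, measurable (A_ n)),
    (forall n, G (x_ n)) -> trivIset setT A_ -> \bigcup_n A_ n = setT ->
  exists2 x, G x & forall n, L0_indic P (mA n) * rm_dist x (x_ n) = 0.

Definition as_bounded G :=
  exists2 xi : L0 P, 0 <= xi &
    L0bar_sup [set L0_EFin (rm_dist xy.1 xy.2) | xy in G `*` G] = L0_EFin xi.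

Definition CB_sigma G :=
  [/\ G !=set0, as_bounded G, closed G & sigma_stable G].

Definition rm_dist_set x G : L0bar P :=
  L0bar_inf [set L0_EFin (rm_dist x g) | g in G].

(* On [CB_sigma] sets the value is the image under [L0_EFin] of a nonnegative
   element of [L0 P]; it is kept in [L0bar P], where the suprema live. *)
Definition random_hausdorff G1 G2 : L0bar P :=
  L0bar_max (L0bar_sup [set rm_dist_set x G2 | x in G1])
            (L0bar_sup [set rm_dist_set x G1 | x in G2]).

End random_hausdorff.

(* Main.v *)
Require Import Defs.
From mathcomp Require Import all_boot all_order all_algebra.
From mathcomp Require Import all_classical all_reals all_analysis.
From mathcomp Require Import measurable_realfun lra.

(** Nadler's iteration works in a random metric space once a random distance
    to a set can be attained up to a constant error, simultaneously for almost
    every sample point.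

    That is the role of sigma-stability.  The infimum defining [d(x, G)] is a
    lattice infimum of almost sure classes, but it is the pointwise infimum of
    countably many of the functions [d(x, g)] ([L0bar_inf_approx]).  Hence if
    [d(x, G) <= c], then almost every sample point belongs to one of the
    events [d(x, g_n) < c + e]; making them disjoint and gluing the [g_n]
    along the resulting partition yields a single [g] in [G] with
    [d(x, g) <= c + e] almost surely ([rm_dist_set_near]).  As every random
    distance [d(u, G2)] with [u] in [G1] is below the Hausdorff distance
    ([le_L0bar_sup]), a point of [T x] has a partner in [T y] at distance at
    most [alpha * d(x, y) + e].

    Iterating with the errors [2^-n] gives a sequence with [x_(n+1)] in
    [T x_n] and [d(x_(n+1), x_(n+2)) <= alpha * d(x_n, x_(n+1)) + 2^-n].  At a
    sample point where [alpha < 1] the steps are summable, since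
    [(1 - alpha) * sum_n d(x_n, x_(n+1)) <= d(x_0, x_1) + 2]
    ([perturbed_contraction_cauchy]).  As [alpha] may come arbitrarily close
    to [1], this is obtained for each sample point separately, and then
    transferred to the (epsilon, lambda) uniformity, for which almost surely
    Cauchy sequences are Cauchy ([cauchy_eps_lambda]).  Let [y] be the limit.  The point
    [x_(n+1)] of [T x_n] has a partner in [T y] at distance at most
    [d(x_n, y) + e], so [y] adheres to the closed set [T y]. *)

Import Order.TTheory GRing.Theory Num.Theory.
Set Implicit Arguments.
Unset Strict Implicit.
Unset Printing Implicit Defensive.
Local Open Scope classical_set_scope.
Local Open Scope ring_scope.

(** * Almost sure comparison *)

Section almost_sure.
Context {d : measure_display} {Omega : measurableType d} {R : realType}.
Variable P : probability Omega R.

Lemma measurable_ltr_set (f g : Omega -> R) :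
  measurable_fun setT f -> measurable_fun setT g ->
  measurable [set w | f w < g w].
Proof.
move=> mf mg; rewrite -[X in measurable X]setTI.
exact: (measurable_fun_ltr mf mg measurableT (Y := [set true])).
Qed.

Lemma le_probability_ae (A B : set Omega) : measurable A -> measurable B ->
  (\forall w \ae P, A w -> B w) -> (P A <= P B)%E.
Proof.
move=> mA mB [N [mN N0 AB]].
rewrite -[leRHS]adde0 -N0; apply: le_trans (measureU2 _ _ _) => //.
apply: le_measure; rewrite ?inE//; first exact: measurableU.
move=> w Aw; have [Bw|nBw] := pselect (B w); first by left.
by right; apply: AB => /= h; exact/nBw/h.
Qed.

Lemma L0_EFinE (f : L0 P) : \forall w \ae P, L0_EFin f w = (f w)%:E.
Proof. exact: L0bar_pi_funE. Qed.

Lemma L0bar_maxE (f g : L0bar P) :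
  \forall w \ae P, L0bar_max f g w = maxe (f w) (g w).
Proof. exact: L0bar_pi_funE. Qed.

End almost_sure.

(** * Essential infima and suprema *)

Lemma ereal_rat_between (R : realType) (x y : \bar R) : (x < y)%E ->
  exists q : rat, (x < (ratr q)%:E < y)%E.
Proof.
move: x y => [x| |] [y| |]//.
- by rewrite lte_fin => /rat_in_itvoo[q]; rewrite in_itv/= => qxy; exists q.
- move=> _; have /rat_in_itvoo[q] : x < x + 1 by rewrite ltrDl.
  by rewrite in_itv/= => /andP[xq _]; exists q; rewrite lte_fin xq ltry.
- move=> _; have /rat_in_itvoo[q] : y - 1 < y by rewrite ltrBlDr ltrDl.
  by rewrite in_itv/= => /andP[_ qy]; exists q; rewrite lte_fin qy ltNyr.
- by move=> _; exists 0; rewrite ltNyr ltry.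
Qed.

Section essential_bounds.
Context {d : measure_display} {Omega : measurableType d} {R : realType}.
Variable P : probability Omega R.

(** An exhaustion argument: among the countable unions of events of the family
    one has maximal probability, and an event sticking out of it with positive
    probability could be added to contradict maximality. *)
Lemma countable_ess_cover (I : Type) (A : set I) (S : I -> set Omega) :
  A !=set0 -> (forall i, measurable (S i)) ->
  exists2 s : nat -> I, (forall n, A (s n)) &
    forall i, A i -> \forall w \ae P, S i w -> exists n, S (s n) w.
Proof.
move=> [i0 Ai0] mS.
pose U (s : nat -> I) := \bigcup_n S (s n).
have mU s : measurable (U s) by apply: bigcupT_measurable => n; exact: mS.
pose F := [set P (U s) | s in [set s | forall n, A (s n)]].
pose c := ereal_sup F.
have cfin : c \is a fin_num.
  apply/fin_real/andP; split.
    apply: (@lt_le_trans _ _ 0%E); first exact: ltNyr.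
    apply: (@le_trans _ _ (P (U (fun=> i0)))); first exact: measure_ge0.
    by apply: ereal_sup_ubound; exists (fun=> i0).
  apply: (@le_lt_trans _ _ 1%E); last exact: ltry.
  by apply: ge_ereal_sup => _ [s _ <-]; exact: probability_le1.
have /choice[sg sgP] : forall k : nat, exists s : nat -> I,
    (forall n, A (s n)) /\ (c - k.+1%:R^-1%:E < P (U s))%E.
  move=> k; have k0 : 0 < k.+1%:R^-1 :> R by [].
  by have [_ [s As <-] cs] := ub_ereal_sup_adherent k0 cfin; exists s.
(* [s] merges all the nearly optimal sequences [sg k] into one. *)
pose s n := let k := odflt (0, 0)%N (unpickle n) in sg k.1 k.2.
have As n : A (s n) by apply: (sgP _).1.
have cU : (c <= P (U s))%E.
  apply/lee_addgt0Pr => e e0.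
  have [k] := filter_ex (near_infty_natSinv_lt (PosNum e0)).
  move=> /= ke; rewrite -leeBlDr//.
  apply: (@le_trans _ _ (c - k.+1%:R^-1%:E)%E).
    by apply: leeB => //; rewrite lee_fin ltW.
  apply: (le_trans (ltW (sgP k).2)); apply: le_measure; rewrite ?inE//.
  move=> w [n _ Sw]; exists (pickle (k, n)) => //.
  by rewrite /s pickleK.
exists s => // i Ai.
pose s' n := if n is m.+1 then s m else i.
have U'E : U s' = U s `|` (S i `\` U s).
  rewrite setDE setUIr setUCr setIT; apply/seteqP; split => w.
    by move=> [[|n] _ Sw]; [right|left; exists n].
  by move=> [[n _ Sw]|Sw]; [exists n.+1|exists 0%N].
exists (S i `\` U s); split; first exact: measurableD.
- have : (P (U s') <= P (U s))%E.
    apply: le_trans cU; apply: ereal_sup_ubound; exists s' => //.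
    by case.
  rewrite U'E measureU//; last 2 first.
  + exact: measurableD.
  + by apply/seteqP; split => // w [Uw []].
  rewrite -leeBrDl ?fin_num_measure// subee ?fin_num_measure// => Ple0.
  by apply/eqP; rewrite eq_le Ple0 measure_ge0.
- move=> w /= nSw; split; apply: contra_notP nSw => //.
  by rewrite not_notE => -[n _ Sw] _; exists n.
Qed.

(** A function is determined by its sublevel events at rational levels, so the
    infimum is found by covering, for each rational [q], all the events
    [f < q] with countably many of them.  Keeping the covering sequence turns
    the lattice infimum into a pointwise one. *)
Lemma L0bar_infimumP (A : set (L0bar P)) : A !=set0 ->
  exists2 s : nat -> L0bar P, (forall n, A (s n)) &
    exists2 i : L0bar P, infimums A i &
      \forall w \ae P, forall c, (i w < c)%E -> exists n, (s n w < c)%E.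
Proof.
move=> A0.
have mlt (f : L0bar P) (q : rat) : measurable [set w | (f w < (ratr q)%:E)%E].
  rewrite -[X in measurable X]setTI.
  exact: emeasurable_fun_infty_o.
have /choice[sg sgP] : forall q : rat, exists s : nat -> L0bar P,
    (forall n, A (s n)) /\ forall f, A f -> \forall w \ae P,
      (f w < (ratr q)%:E)%E -> exists n, (s n w < (ratr q)%:E)%E.
  by move=> q; have [s ? ?] := countable_ess_cover A0 (mlt ^~ q); exists s.
pose s n := let k := odflt (0, 0%N) (unpickle n) in sg k.1 k.2.
have As n : A (s n) by apply: (sgP _).1.
have minf : measurable_fun setT (fun w => einfs (fun n => s n w) 0).
  exact: measurable_fun_einfs.
exists s => //; exists (L0bar_pi P minf); last first.
  apply: filterS (L0bar_pi_funE P minf) => w -> c.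
  by move=> /ereal_inf_lt[_ [n _ <-] snc]; exists n.
split=> [f Af|g gA]; last first.
  apply/L0bar_leP; have /ae_foralln gs n := (L0bar_leP _ _ (gA _ (As n))).
  apply: filterS2 gs (L0bar_pi_funE P minf) => w gs ->.
  by apply: le_ereal_inf_tmp => _ [n _ <-].
apply/L0bar_leP.
have /ae_foralln fs n := (sgP (odflt 0 (unpickle n))).2 _ Af.
apply: filterS2 fs (L0bar_pi_funE P minf) => w fs ->.
rewrite leNgt; apply/negP => /ereal_rat_between[q /andP[fq]].
apply/negP; rewrite -leNgt.
have := fs (pickle q); rewrite pickleK /= => /(_ fq)[n sq].
apply: (le_trans _ (ltW sq)); apply: ereal_inf_lbound.
by exists (pickle (q, n)) => //; rewrite /s pickleK.
Qed.

Lemma L0bar_inf_approx (A : set (L0bar P)) : A !=set0 ->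
  exists2 s : nat -> L0bar P, (forall n, A (s n)) &
    \forall w \ae P, forall c, (L0bar_inf A w < c)%E ->
      exists n, (s n w < c)%E.
Proof.
move=> A0; have [s As [i iA si]] := L0bar_infimumP A0.
exists s => //; suff -> : L0bar_inf A = i by [].
rewrite /L0bar_inf /infimum; case: eqP A0 => [->[]//|_ _].
case: xgetP => [y _ [yA Ay]|/(_ i)//].
by case: iA => iA Ai; apply/le_anti; rewrite Ay ?Ai.
Qed.

(** The supremum exists because it is the infimum of the upper bounds, a family
    that contains the constant [+oo]; without existence [L0bar_sup] would be
    its default value. *)
Lemma le_L0bar_sup (A : set (L0bar P)) f : A f -> f <= L0bar_sup A.
Proof.
move=> Af; have [|s _ [i [iA Ai] _]] := @L0bar_infimumP (ubound A).
  exists (L0bar_pi P (measurable_cst +oo%E)) => g _; apply/L0bar_leP.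
  apply: filterS (L0bar_pi_funE P (measurable_cst +oo%E)) => w ->.
  exact: leey.
rewrite /L0bar_sup /supremum; case: eqP Af => [->//|_ Af].
case: xgetP => [y _ [yA _]|/(_ i) []]; first exact: yA.
by split=> // g Ag; apply: Ai => u uA; exact: uA.
Qed.

End essential_bounds.

(** * Nearly attained random distances *)

Section random_metric.
Context {d : measure_display} {Omega : measurableType d} {R : realType}.
Context {P : probability Omega R}.
Variable E : rmSpace P.
Implicit Types (x y u v : E) (G : set E).

Lemma rm_dist_ge0_ae x y : \forall w \ae P, 0 <= rm_dist x y w.
Proof.
have /L0_leP := rm_dist_ge0 x y.
by apply: filterS2 L0_0E => w /= ->.
Qed.

Lemma rm_distxx_ae x : \forall w \ae P, rm_dist x x w = 0.
Proof. by have -> := (rm_dist_eq0 x x).2 erefl; exact: L0_0E. Qed.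

Lemma rm_dist_triangle_ae x y z :
  \forall w \ae P, rm_dist x z w <= rm_dist x y w + rm_dist y z w.
Proof.
have /L0_leP := rm_dist_triangle x y z.
by apply: filterS2 (L0_DE (rm_dist x y) (rm_dist y z)) => w /= ->.
Qed.

(** Countably many points of [G] come within [c + e] of [x] on events that
    cover almost every sample point; sigma-stability glues them along the
    disjointified cover. *)
Lemma rm_dist_set_near G x (c : L0 P) (e : R) :
    G !=set0 -> sigma_stable G -> rm_dist_set x G <= L0_EFin c -> 0 < e ->
  exists2 g, G g & \forall w \ae P, rm_dist x g w <= c w + e.
Proof.
move=> [g0 Gg0] Gs xGc e0.
have [|s sG sinf] := @L0bar_inf_approx _ _ _ P
    [set L0_EFin (rm_dist x g) | g in G].
  by exists (L0_EFin (rm_dist x g0)); exists g0.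
have /choice[g gs] : forall n, exists g, G g /\ L0_EFin (rm_dist x g) = s n.
  by move=> n; have [g Gg <-] := sG n; exists g.
pose B n := [set w | rm_dist x (g n) w < c w + e].
have mB n : measurable (B n).
  apply: measurable_ltr_set; first exact: measurable_funPT.
  by apply: measurable_funD => //; exact: measurable_funPT.
(* The null event missed by all the [B n] is added as first piece, since a
   partition must cover every sample point. *)
pose D n := if n is m.+1 then B m else ~` \bigcup_m B m.
pose h n := if n is m.+1 then g m else g0.
have mD n : measurable (seqDU D n).
  apply: seqDU_measurable => -[|m] /=; last exact: mB.
  exact/measurableC/bigcupT_measurable.
have Gh n : G (h n) by case: n => [//|n]; apply: (gs n).1.
have DT : \bigcup_n seqDU D n = setT.
  rewrite -seqDU_bigcup_eq; apply/seteqP; split => // w _.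
  have [[n _ Bw]|nBw] := pselect ((\bigcup_m B m) w); first by exists n.+1.
  by exists 0%N.
have [v Gv vh] := Gs _ _ mD Gh (@trivIset_seqDU _ D) DT.
exists v => //.
have /ae_foralln hv n : \forall w \ae P, seqDU D n w -> rm_dist v (h n) w = 0.
  have /L0_eqP vh0 := vh n.
  apply: filterS3 (filterI vh0 L0_0E) (L0_indicE P (mD n))
    (L0_ME (L0_indic P (mD n)) (rm_dist v (h n))) => w [{}vh0 zE] iE mE Dw.
  by move: vh0; rewrite mE iE zE indicE mem_set// mul1r.
have /ae_foralln tri n := rm_dist_triangle_ae x (h n) v.
have /ae_foralln sE n : \forall w \ae P, s n w = (rm_dist x (g n) w)%:E.
  by rewrite -(gs n).2; exact: L0_EFinE.
have xGc' : \forall w \ae P, (rm_dist_set x G w <= (c w)%:E)%E.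
  have /L0bar_leP := xGc.
  by apply: filterS2 (L0_EFinE c) => w ->.
apply: filterS3 (filterI hv tri) (filterI sinf xGc') sE => w.
move=> [{}hv {}tri] [{}sinf {}xGc] {}sE.
have [n Dw] : exists n, seqDU D n w.
  by have : setT w by []; rewrite -DT => -[n _ Dw]; exists n.
have [m] : exists m, (s m w < (c w + e)%:E)%E.
  by apply: sinf; apply: (le_lt_trans xGc); rewrite lte_fin ltrDl.
rewrite sE lte_fin => Bmw.
have := subset_seqDU Dw; case: n Dw => [_ []|n Dw /= Bnw]; first by exists m.
apply: le_trans (tri n.+1) _; rewrite (rm_distC (h n.+1)) (hv n.+1 Dw) addr0.
exact: ltW.
Qed.

Lemma random_hausdorff_near G1 G2 u (c : L0 P) (e : R) :
    G2 !=set0 -> sigma_stable G2 -> random_hausdorff G1 G2 <= L0_EFin c ->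
    G1 u -> 0 < e ->
  exists2 v, G2 v & \forall w \ae P, rm_dist u v w <= c w + e.
Proof.
move=> G20 G2s H12 G1u; apply: rm_dist_set_near => //.
have le_sup : rm_dist_set u G2 <= L0bar_sup [set rm_dist_set x G2 | x in G1].
  by apply: le_L0bar_sup; exists u.
apply: le_trans le_sup (le_trans _ H12); apply/L0bar_leP.
rewrite /random_hausdorff; set S1 := L0bar_sup _; set S2 := L0bar_sup _.
by apply: filterS (L0bar_maxE S1 S2) => w ->; rewrite le_max lexx.
Qed.

(** * Convergence of the iteration *)

Lemma measurable_rm_dist_lt x y (e : R) :
  measurable [set w | rm_dist x y w < e].
Proof. by apply: measurable_ltr_set; [exact: measurable_funPT|]. Qed.

(** The events [G N], on which all distances beyond the rank [N] are small,
    increase to an almost sure event, so their probability exceeds [1 - l] for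
    some [N]. *)
Lemma cauchy_eps_lambda (x : nat -> E) :
    (\forall w \ae P, forall e : R, 0 < e -> exists N, forall n m,
      (N <= n)%N -> (N <= m)%N -> rm_dist (x n) (x m) w < e) ->
  cauchy (x @ \oo).
Proof.
move=> xC A [[e l] /= [e0 /andP[l0 l1]] elA].
pose G N := [set w | forall n m, (N <= n)%N -> (N <= m)%N ->
                       rm_dist (x n) (x m) w < e].
have mG N : measurable (G N).
  have -> : G N = \bigcap_(n in [set n | (N <= n)%N])
                  \bigcap_(m in [set m | (N <= m)%N])
                  [set w | rm_dist (x n) (x m) w < e].
    by apply/seteqP; split => w h n => [Nn m|m Nn]; exact: h.
  apply: bigcap_measurable => [|n _]; first by exists N => /=.
  apply: bigcap_measurable => [|m _]; first by exists N => /=.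
  exact: measurable_rm_dist_lt.
have mUG : measurable (\bigcup_n G n) by exact: bigcupT_measurable.
have ndG : {homo G : n m / (n <= m)%N >-> (n <= m)%O}.
  move=> N M NM; apply/subsetPset => w Gw n m Mn Mm.
  by apply: Gw; exact: leq_trans NM _.
have UG : P (\bigcup_n G n) = 1%E.
  apply/eqP; rewrite eq_le probability_le1//=.
  rewrite -(@probability_setT _ _ _ P); apply: le_probability_ae => //.
  by apply: filterS xC => w /(_ _ e0)[N Nw] _; exists N.
have : \forall N \near \oo, ((1 - l)%:E < P (G N))%E.
  have PG1 : (P \o G) N @[N --> \oo] --> 1%E.
    by rewrite -UG; exact: nondecreasing_cvg_mu.
  apply: (PG1 [set p | ((1 - l)%:E < p)%E]); apply: open_nbhs_nbhs; split.
    exact: open_ereal_gt_ereal.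
  by rewrite /= lte_fin gtrBl.
move=> /filter_ex[N PGN].
exists ([set y | exists2 n, (N <= n)%N & y = x n],
        [set y | exists2 n, (N <= n)%N & y = x n]) => /=.
  by split; exists N => // n Nn; exists n.
move=> [_ _] /= [[n Nn ->] [m Nm ->]]; apply: elA; rewrite /eps_lambda/=.
apply: lt_le_trans PGN _; apply: le_probability_ae => //.
  exact: measurable_rm_dist_lt.
by apply: aeW => w; exact.
Qed.

End random_metric.

(** What happens at a fixed sample point, with [D n m] the distance of the
    iterates [n] and [m]: the summable errors [2^-n] do not spoil the
    summability of the steps. *)
Lemma perturbed_contraction_cauchy (R : realType) (a : R)
    (D : nat -> nat -> R) :
    a < 1 ->
    (forall n m, 0 <= D n m) -> (forall n m, D n m = D m n) ->
    (forall n, D n n = 0) -> (forall n m p, D n p <= D n m + D m p) ->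
    (forall n, D n.+1 n.+2 <= a * D n n.+1 + 2^-1 ^+ n) ->
  forall e, 0 < e -> exists N, forall n m,
    (N <= n)%N -> (N <= m)%N -> D n m < e.
Proof.
move=> a1 D0 DC Dxx Dtri Dstep e e0.
pose S N := \sum_(n < N) D n n.+1.
have SS N : S N.+1 = S N + D N N.+1 by rewrite /S big_ord_recr.
(* The last step and the geometric tail make the bound inductive. *)
have Sbnd N : (1 - a) * S N + D N N.+1 <= D 0 1 + 2 - 2 * 2^-1 ^+ N.
  elim: N => [|N IH]; first by rewrite /S big_ord0 expr0; lra.
  by move: (Dstep N) IH; rewrite SS exprS; lra.
have Snd : {homo S : n m / (n <= m)%N >-> n <= m}.
  by apply: homo_leq => [||n]; [|exact: le_trans|rewrite SS lerDl].
have Scvg : cvgn S.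
  apply: nondecreasing_is_cvgn => //.
  exists ((D 0 1 + 2) / (1 - a)) => _ [N _ <-].
  rewrite ler_pdivlMr ?subr_gt0// mulrC.
  have := Sbnd N; have := D0 N N.+1.
  have : 0 <= 2^-1 ^+ N :> R by rewrite exprn_ge0.
  lra.
have DS n k : D n (n + k)%N <= S (n + k)%N - S n.
  elim: k => [|k IH]; first by rewrite addn0 Dxx subrr.
  rewrite addnS SS; have := Dtri n (n + k)%N (n + k).+1; lra.
have /cvgrPdist_lt/(_ (e / 2))[|N _ SN] := Scvg; first by rewrite divr_gt0.
have Dle n m : (N <= n)%N -> (n <= m)%N -> D n m < e.
  move=> Nn nm; have := DS n (m - n)%N; rewrite subnKC//.
  have := SN _ Nn; have := SN _ (leq_trans Nn nm); rewrite /= !ltr_norml.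
  lra.
exists N => n m Nn Nm; have [nm|/ltnW mn] := leqP n m; first exact: Dle.
by rewrite DC; exact: Dle.
Qed.

Theorem theorem3p12 (d : measure_display) (Omega : measurableType d)
    (R : realType) (P : probability Omega R) (E : rmSpace P)
    (Ecomplete : eps_lambda_complete E)
    (alpha : L0 P) (alpha_ge0 : 0 <= alpha)
    (alpha_lt1 : \forall w \ae P, alpha w < 1)
    (T : E -> set E) (T_CB : forall x, CB_sigma (T x))
    (T_contr : forall x y,
      random_hausdorff (T x) (T y) <= L0_EFin (alpha * rm_dist x y)) :
  exists x : E, T x x.
Proof.
have near_T x y u (e : R) : T x u -> 0 < e -> exists2 v, T y v &
    \forall w \ae P, rm_dist u v w <= alpha w * rm_dist x y w + e.
  move=> Txu e0; have [Ty0 _ _ Tys] := T_CB y.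
  have [v Tyv uv] := random_hausdorff_near Ty0 Tys (T_contr x y) Txu e0.
  by exists v => //; apply: filterS2 uv (L0_ME alpha (rm_dist x y)) => w + <-.
have [x0] := rm_nonempty E; have [[x1 Tx01] _ _ _] := T_CB x0.
have /choice[f fP] : forall p : nat * (E * E), exists v, T p.2.1 p.2.2 ->
    T p.2.2 v /\ \forall w \ae P,
      rm_dist p.2.2 v w <= alpha w * rm_dist p.2.1 p.2.2 w + 2^-1 ^+ p.1.
  move=> [n [x u]] /=; have [Txu|] := pselect (T x u); last by exists x0.
  have e0 : 0 < 2^-1 ^+ n :> R by rewrite exprn_gt0.
  by have [v] := near_T x u u _ Txu e0; exists v.
(* The state is a pair of consecutive iterates, since the next one is selected
   through the contraction between the images of both. *)
pose fix orb (n : nat) : E * E :=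
  if n is m.+1 then ((orb m).2, f (m, orb m)) else (x0, x1).
pose x n := (orb n).1.
have Torb n : T (x n) (x n.+1).
  elim: n => [//|n IH]; exact: (fP (n, orb n) IH).1.
have xstep n := (fP (n, orb n) (Torb n)).2.
have xC : cauchy (x @ \oo).
  apply: cauchy_eps_lambda.
  have D0 := ae_foralln (fun n => ae_foralln (fun m =>
    rm_dist_ge0_ae (x n) (x m))).
  have Dxx := ae_foralln (fun n => rm_distxx_ae (x n)).
  have Dtri := ae_foralln (fun n => ae_foralln (fun m => ae_foralln (fun p =>
    rm_dist_triangle_ae (x n) (x m) (x p)))).
  have Dstep := ae_foralln xstep.
  apply: filterS3 (filterI alpha_lt1 D0) (filterI Dxx Dtri) Dstep.
  move=> w [a1 {}D0] [{}Dxx {}Dtri] {}Dstep.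
  apply: (@perturbed_contraction_cauchy _ (alpha w)
    (fun n m => rm_dist (x n) (x m) w)) => // n m.
  by rewrite rm_distC.
have [y xy] := Ecomplete (x @ \oo) _ xC.
exists y; have [_ _ Tycl _] := T_CB y; apply: Tycl => B.
rewrite rm_nbhsE -rm_entourageE => -[A entA AB].
(* A point of [T y] in [B] is found as a partner [v] of [x n.+1]: the first
   step of the chain from [y] to [x n.+1] to [v] is small by convergence, the
   second because [d(x n.+1, v)] is at most [d(x n, y) + e / 2]. *)
have [C entC CA] := entourage_split_ex entA.
have [[e l] /= [e0 l01] elC] := entC.
have e20 : 0 < e / 2 by rewrite divr_gt0.
have nC : \forall n \near \oo, C (y, x n).
  have yC : nbhs y (xsection C y) by rewrite rm_nbhsE; exists C.
  have xyC : \forall n \near \oo, xsection C y (x n) := xy _ yC.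
  by apply: filterS xyC => n; rewrite /xsection/= inE.
have nD : \forall n \near \oo, eps_lambda (e / 2, l) (y, x n).
  have yD : nbhs y (xsection (eps_lambda (e / 2, l)) y).
    rewrite rm_nbhsE; exists (eps_lambda (e / 2, l)) => //.
    by exists (e / 2, l).
  have xyD : \forall n \near \oo, xsection (eps_lambda (e / 2, l)) y (x n).
    exact: xy _ yD.
  by apply: filterS xyD => n; rewrite /xsection/= inE.
have [[N _ NC] [M _ MD]] := (nC, nD); pose n := (N + M)%N.
have Cn : C (y, x n.+1) by apply: NC; rewrite /= leqW// leq_addr.
have Dn : eps_lambda (e / 2, l) (y, x n) by apply: MD; rewrite /= leq_addl.
have [v Tyv uv] := near_T (x n) y (x n.+1) _ (Torb n) e20.
exists v; split => //; apply: AB; rewrite /xsection/= inE.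
apply: CA; exists (x n.+1) => //; apply: elC; rewrite /eps_lambda/=.
apply: lt_le_trans Dn _; apply: le_probability_ae.
- exact: measurable_rm_dist_lt.
- exact: measurable_rm_dist_lt.
apply: filterS3 uv alpha_lt1 (rm_dist_ge0_ae (x n) y) => w uv a1 d0 /=.
rewrite rm_distC => xne; apply: (le_lt_trans uv).
have : alpha w * rm_dist (x n) y w <= rm_dist (x n) y w.
  by rewrite ler_piMl// ltW.
by move: xne; lra.
Qed.
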